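(* Let $A$ be a BJ-algebra over a field $F$ of characteristic $\neq 2$. Then: (a) $A$ has an element $e$ such that $ae=ea=a$ for every $a\in A^2$; (b) the algebra $A$ has no nonzero nilpotent elements which have square roots, i.e. if $a\in A^2$ and $a^n=0$ for some integer $n\geq 1$, then $a=0$.
   Context: For a Jordan algebra $A$ over a field $F$ of characteristic $\neq 2$ (not assumed unital), write $A^2=\{a^2: a\in A\}$ (the set of squares, i.e. the elements having a square root in $A$), $U_ab=2(ab)a-a^2b$, $U_a(A)=\{U_ax: x\in A\}$, and for $S\subseteq A$ put ${}^\perp S=\{x\in A: U_ax=0 \text{ for all } a\in S\}$. $A$ is called a BJ-algebra if for every subset $S\subseteq A$ there exists an idempotent $e\in A$ such that ${}^\perp S\cap A^2=U_e(A)\cap A^2$. An idempotent is an element $e$ with $e^2=e$ (the zero element is allowed). *)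

(* Defs.v *)
From HB Require Import structures.
From mathcomp Require Import all_boot all_order all_algebra.
From mathcomp Require Import classical_sets.
Set Implicit Arguments.
Unset Strict Implicit.
Unset Printing Implicit Defensive.
Import GRing.Theory.
Local Open Scope classical_set_scope.
Local Open Scope ring_scope.

(* Neither associativity nor a unit nor finite dimension is assumed. Linearity
   in the second argument follows from commutativity. *)
HB.mixin Record Lmodule_isJordan (F : fieldType) A of GRing.Lmodule F A := {
  jmul : A -> A -> A;
  jmulC : commutative jmul;
  jmulDl : left_distributive jmul +%R;
  jscalerAl : forall (k : F) (x y : A), k *: jmul x y = jmul (k *: x) y;
  jordan_identity : forall x y : A,
    jmul (jmul (jmul x x) y) x = jmul (jmul x x) (jmul y x);
}.

#[short(type="jordanAlgType")]
HB.structure Definition JordanAlgebra (F : fieldType) :=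
  { A of GRing.Lmodule F A & Lmodule_isJordan F A }.

Declare Scope jordan_scope.
Delimit Scope jordan_scope with J.
Infix "**" := jmul (at level 40, left associativity) : jordan_scope.
Local Open Scope jordan_scope.

Section BJ.
Variables (F : fieldType) (A : jordanAlgType F).
Implicit Types (a b e x : A) (S : set A) (n : nat).

(* The product of n factors a ** (a ** ... (a ** a)), meant for n > 0 only: A
   has no unit, and the value 0 at n = 0 is a dummy. *)
Definition jexp a n : A := iterop n jmul a 0.

Definition jidempotent e : Prop := e ** e = e.

Definition jsquares : set A := range (fun a => a ** a).

Definition jU a b : A := ((a ** b) ** a) *+ 2 - (a ** a) ** b.

Definition jperp S : set A := [set x | forall a, S a -> jU a x = 0].

Definition BJ_algebra : Prop :=
  forall S, exists e,
    jidempotent e /\ jperp S `&` jsquares = range (jU e) `&` jsquares.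

End BJ.

Arguments jsquares {F} A.
Arguments BJ_algebra {F} A.

(* Main.v *)
Require Import Defs.
From HB Require Import structures.
From mathcomp Require Import all_boot all_order all_algebra.
From mathcomp Require Import classical_sets.
Set Implicit Arguments.
Unset Strict Implicit.
Unset Printing Implicit Defensive.
Import GRing.Theory.
Local Open Scope classical_set_scope.
Local Open Scope ring_scope.
Local Open Scope jordan_scope.

(** Applying the hypothesis to the empty set gives an idempotent [u] acting as
    the identity on squares, hence on all products since
    [2 xy = (x + y)^2 - x^2 - y^2].

    For (b), the main point is that an idempotent [e] admits no nonzero [h] with
    [eh = h/2] and [eh^2 = h^2].  Indeed for [f = u - e] the idempotent attached
    to the set [{f}] is [e] itself, while [(e + h)^2 = e + h + h^2] is a square
    annihilated by [U_f]; so [e] fixes it, which forces [h = 0].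

    If [b^4 = 0], then [U_b (b^2) = 0], so the idempotent [e] attached to [{b}]
    satisfies [eb^2 = b^2] and [U_b e = 0].  Comparing Peirce components of [b]
    with respect to [e] shows that the middle one, [h], satisfies [h^2 = b^2],
    hence [h = 0] and [b^2 = 0].  Power associativity makes every power of a
    square a square and reduces [a^n = 0] to this case. *)

(** * A decision procedure for identities in an abelian group *)

Inductive zexpr :=
  | ZAtom of nat | ZZero | ZAdd of zexpr & zexpr | ZOpp of zexpr
  | ZMuln of zexpr & nat.

Fixpoint zeval (V : zmodType) (env : seq V) (t : zexpr) : V :=
  match t with
  | ZAtom i => env`_i
  | ZZero => 0
  | ZAdd t1 t2 => zeval env t1 + zeval env t2
  | ZOpp t1 => - zeval env t1
  | ZMuln t1 n => zeval env t1 *+ n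
  end.

(* The multiplicity of the atom [i] in [t] with sign [+] ([s = false]) or [-]
   ([s = true]). *)
Fixpoint zmult (t : zexpr) (s : bool) (i : nat) : nat :=
  match t with
  | ZAtom j => if s then 0%N else nat_of_bool (eqn j i)
  | ZZero => 0%N
  | ZAdd t1 t2 => (zmult t1 s i + zmult t2 s i)%N
  | ZOpp t1 => zmult t1 (~~ s) i
  | ZMuln t1 n => (zmult t1 s i * n)%N
  end.

Lemma zevalE (V : zmodType) (env : seq V) (t : zexpr) :
  zeval env t =
  \sum_(i < size env) (env`_i *+ zmult t false i - env`_i *+ zmult t true i).
Proof.
elim: t => [j||t1 IH1 t2 IH2|t1 IH1|t1 IH1 n] /=.
- have [lt_j|le_j] := ltnP j (size env).
    rewrite (bigD1 (Ordinal lt_j)) //= eqnE eqxx subr0 big1 ?addr0 // => i.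
    by rewrite -val_eqE /= eq_sym => /negPf->; rewrite subrr.
  rewrite nth_default // big1 // => i _.
  by rewrite eqnE gtn_eqF ?subrr // (leq_trans (ltn_ord i)).
- by rewrite big1 // => i _; rewrite subrr.
- rewrite IH1 IH2 -big_split; apply: eq_bigr => i _ /=.
  by rewrite !mulrnDr opprD addrACA.
- by rewrite IH1 -sumrN; apply: eq_bigr => i _; rewrite opprB.
- by rewrite IH1 -sumrMnl; apply: eq_bigr => i _; rewrite mulrnBl !mulrnA.
Qed.

(** Moving the negative multiplicities across leaves one equality of natural numbers per atom,
    decided by computation. *)
Lemma zeval_eq (V : zmodType) (env : seq V) (t1 t2 : zexpr) :
  all (fun i => eqn (zmult t1 false i + zmult t2 true i)
                    (zmult t2 false i + zmult t1 true i)) (iota 0 (size env)) ->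
  zeval env t1 = zeval env t2.
Proof.
move=> /allP eq12; rewrite !zevalE; apply: eq_bigr => i _.
apply/eqP; rewrite subr_eq addrAC eq_sym subr_eq eq_sym -!mulrnDr; apply/eqP.
by congr (_ *+ _); apply/eqP/eq12; rewrite mem_iota /=.
Qed.

Ltac zatoms env t :=
  lazymatch t with
  | ?x + ?y => let env' := zatoms env x in zatoms env' y
  | - ?x => zatoms env x
  | ?x *+ _ => zatoms env x
  | 0 => env
  | _ => zinsert env t
  end
with zinsert env t :=
  lazymatch env with
  | context [t :: _] => env
  | _ => constr:(t :: env)
  end.

Ltac zindex env t :=
  lazymatch env with
  | t :: _ => constr:(0%N)
  | _ :: ?env' => let i := zindex env' t in constr:(i.+1)
  end.

Ltac zreify env t :=
  lazymatch t with
  | ?x + ?y =>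
      let rx := zreify env x in let ry := zreify env y in constr:(ZAdd rx ry)
  | - ?x => let rx := zreify env x in constr:(ZOpp rx)
  | ?x *+ ?n => let rx := zreify env x in constr:(ZMuln rx n)
  | 0 => constr:(ZZero)
  | _ => let i := zindex env t in constr:(ZAtom i)
  end.

Ltac zmodule :=
  lazymatch goal with
  | |- @eq ?V ?x ?y =>
    let env := zatoms (@nil V) x in
    let env := zatoms env y in
    let rx := zreify env x in
    let ry := zreify env y in
    refine (@zeval_eq _ env rx ry _); reflexivity
  end.

Lemma eq_subr0 (V : zmodType) (x y : V) : x = y -> x - y = 0.
Proof. by move->; rewrite subrr. Qed.

(* Closes [x = y] when [x - y] is formally the difference of the sides of [E]. *)
Ltac zcombine E :=
  apply: subr0_eq;
  lazymatch type of E with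
  | ?l = ?r => transitivity (l - r); [zmodule | exact: eq_subr0 E]
  end.

(** * Identities in Jordan algebras *)

Lemma cubic_polarization (V W : zmodType) (g : V -> V -> V -> W) :
  (forall p q r, g p q r = g q p r) ->
  (forall p p' q r, g (p + p') q r = g p q r + g p' q r) ->
  (forall p q r r', g p q (r + r') = g p q r + g p q r') ->
  (forall p, g p p p = 0) ->
  forall p q r, (g p q r + g q r p + g r p q) *+ 2 = 0.
Proof.
move=> gC gDl gDr g0 p q r.
have gDm a b b' c : g a (b + b') c = g a b c + g a b' c by rewrite gC gDl !(gC a).
(* The part of the cubic form at [a + b] of degree 2 in [a] and 1 in [b]; polarizing it once more in
   [a] gives the claim. *)
pose k a b := g a a b + (g a b a) *+ 2.
have k_anti a b : k a b + k b a = 0.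
  have := g0 (a + b); rewrite !(gDl, gDm, gDr) !g0 !(gC b a) => E.
  by rewrite /k !(gC b a); zcombine E.
have := k_anti (p + q) r; move: (k_anti p r) (k_anti q r).
rewrite /k !(gDl, gDm, gDr) !(gC q p) !(gC r p) !(gC r q) => E1 E2 E3.
have E := congr2 +%R E3 (esym (congr2 +%R E1 E2)).
by zcombine E.
Qed.

Section JordanIdentities.
Variables (F : fieldType) (A : jordanAlgType F).
Implicit Types (x y z w a b c e h : A).

Lemma jmulDr x y z : x ** (y + z) = x ** y + x ** z.
Proof. by rewrite jmulC jmulDl !(jmulC x). Qed.

Lemma jmul0 x : x ** 0 = 0.
Proof. by apply: (addrI (x ** 0)); rewrite -jmulDr !addr0. Qed.

Lemma jmul0l x : 0 ** x = 0.
Proof. by rewrite jmulC jmul0. Qed.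

Lemma jmulN x y : x ** (- y) = - (x ** y).
Proof. by apply/eqP; rewrite -addr_eq0 -jmulDr addNr jmul0. Qed.

Lemma jmulNl x y : (- x) ** y = - (x ** y).
Proof. by rewrite jmulC jmulN jmulC. Qed.

Lemma jmulMn x y n : x ** (y *+ n) = (x ** y) *+ n.
Proof. by elim: n => [|n IHn]; rewrite ?jmul0 // !mulrS jmulDr IHn. Qed.

Lemma jmulMnl x y n : (x *+ n) ** y = (x ** y) *+ n.
Proof. by rewrite jmulC jmulMn jmulC. Qed.

Hypothesis F2 : 2%N \notin [pchar F].

Lemma jmulr2n_eq0 x : x *+ 2 = 0 -> x = 0.
Proof.
move=> /eqP; rewrite -scaler_nat scaler_eq0; case/orP => [F2_0|/eqP//].
by move: F2; rewrite inE /= F2_0.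
Qed.

Lemma jmulr2n_inj x y : x *+ 2 = y *+ 2 -> x = y.
Proof.
by move=> E; apply/subr0_eq/jmulr2n_eq0; rewrite mulrnBl E subrr.
Qed.

(** The Jordan identity is cubic in [x]; its polarization is twice this one, and 2 can be
    cancelled. *)
Lemma jordan_linearized x z w y :
  ((x ** z) ** y) ** w + ((z ** w) ** y) ** x + ((w ** x) ** y) ** z =
  (x ** z) ** (y ** w) + (z ** w) ** (y ** x) + (w ** x) ** (y ** z).
Proof.
apply/eqP; rewrite -subr_eq0; apply/eqP/jmulr2n_eq0.
transitivity ((x ** z ** y ** w - x ** z ** (y ** w) +
  (z ** w ** y ** x - z ** w ** (y ** x)) +
  (w ** x ** y ** z - w ** x ** (y ** z))) *+ 2); first by zmodule.
apply: (@cubic_polarization _ _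
  (fun p q r => p ** q ** y ** r - p ** q ** (y ** r))) => {x z w}.
- by move=> p q r; rewrite (jmulC p).
- by move=> p p' q r; rewrite !jmulDl opprD addrACA.
- by move=> p q r r'; rewrite !jmulDr opprD addrACA.
- by move=> p; rewrite jordan_identity subrr.
Qed.

(** The linearized identity, read as an equality of operators on [z] and solved for multiplication
    by [a (b c)]. *)
Lemma jmul_jmul3 a b c z :
  (a ** (b ** c)) ** z =
  (a ** b) ** (c ** z) + (a ** c) ** (b ** z) + (b ** c) ** (a ** z)
  - b ** (a ** (c ** z)) - c ** (a ** (b ** z)).
Proof.
have := jordan_linearized b z c a.
rewrite (jmulC _ c) (jmulC (b ** z) a) (jmulC z c) (jmulC _ b) (jmulC (c ** z) a).
rewrite (jmulC c b) (jmulC (b ** c) a) (jmulC (b ** z)) (jmulC (c ** z)) => E.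
by zcombine E.
Qed.

Lemma jexpS x n : jexp x n.+2 = x ** jexp x n.+1.
Proof. by []. Qed.

(* [jmul_jmul3] with [a = b = x] and [c = x^(n+1)] writes multiplication by
   [x^(n+3)] through operators that commute with multiplication by [x]. *)
Lemma jmul_jexp_comm x n y :
  jexp x n.+1 ** (x ** y) = x ** (jexp x n.+1 ** y).
Proof.
have sqx z : (x ** x) ** (x ** z) = x ** ((x ** x) ** z).
  by rewrite (jmulC x z) -jordan_identity jmulC.
suff [] : (forall y, jexp x n.+1 ** (x ** y) = x ** (jexp x n.+1 ** y)) /\
  (forall y, jexp x n.+2 ** (x ** y) = x ** (jexp x n.+2 ** y)) by [].
elim: n {y} => [|n [IH1 IH2]]; first by split=> y //; apply: sqx.
split=> // y; rewrite !(jexpS x n.+1) (jexpS x n) !jmul_jmul3 -jexpS.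
by rewrite !(jmulDr, jmulN) !IH2 !IH1 !sqx.
Qed.

Lemma jexpD x m n : jexp x m.+1 ** jexp x n.+1 = jexp x (m + n).+2.
Proof.
elim: n => [|n IHn]; first by rewrite addn0 jmulC.
by rewrite jexpS jmul_jexp_comm IHn addnS.
Qed.

Lemma jexp_sqr x n : jexp (x ** x) n.+1 = jexp x n.+1 ** jexp x n.+1.
Proof.
elim: n => [//|n IHn]; rewrite jexpS IHn !jexpD.
by rewrite -[x ** x]/(jexp x 2) (jexpD x 1) add1n addSn addnS.
Qed.

(** * Peirce decomposition with respect to an idempotent *)

Section Peirce.
Variable e : A.
Hypothesis ee : jidempotent e.

Lemma jU_idem x : jU e x = (e ** (e ** x)) *+ 2 - e ** x.
Proof. by rewrite /jU ee (jmulC _ e). Qed.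

(** With [L] for multiplication by [e] this is [L (2L - 1) (L - 1) = 0]. The projections onto the
    eigenvalues 1, 1/2 and 0 are [2L^2 - L], which is [jU e], then [4(L - L^2)] and
    [(1 - L)(1 - 2L)]. *)
Lemma peirce_cubic x :
  (e ** (e ** (e ** x))) *+ 2 + e ** x = (e ** (e ** x)) *+ 3.
Proof. by have := jmul_jmul3 e e e x; rewrite !ee => E; zcombine E. Qed.

Lemma peirce_one x : e ** jU e x = jU e x.
Proof.
have E := peirce_cubic x.
by rewrite jU_idem jmulDr jmulN jmulMn; zcombine E.
Qed.

Lemma peirce_half x :
  (e ** (e ** x - e ** (e ** x))) *+ 2 = e ** x - e ** (e ** x).
Proof.
have /esym E := peirce_cubic x.
by rewrite jmulDr jmulN; zcombine E.
Qed.

Lemma peirce_zero x : e ** (x - jU e x - (e ** x - e ** (e ** x)) *+ 4) = 0.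
Proof.
have E := peirce_cubic x.
by rewrite jU_idem !(jmulDr, jmulN, jmulMn); zcombine E.
Qed.

Lemma peirce_mul p q :
  (e ** q) ** p + (e ** ((e ** p) ** q)) *+ 2 =
  e ** (p ** q) + ((e ** p) ** (e ** q)) *+ 2.
Proof.
have := jordan_linearized e e p q.
rewrite ee (jmulC p e) (jmulC q p) (jmulC q e) (jmulC _ e) => E.
by zcombine E.
Qed.

(** Consequently multiplication by such a [p] preserves every Peirce space of [e]. *)
Lemma peirce_one_mul p q : e ** p = p -> e ** (p ** q) = p ** (e ** q).
Proof.
by move=> ep; have := peirce_mul p q; rewrite ep (jmulC _ p) => E; zcombine E.
Qed.

Lemma peirce_zero_mul p q : e ** p = 0 -> e ** (p ** q) = p ** (e ** q).
Proof.
move=> ep; have := peirce_mul p q; rewrite ep (jmulC _ p) !jmul0l jmul0 => /esym E.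
by zcombine E.
Qed.

(** This says that [h^2] has no component for the eigenvalue 1/2. *)
Lemma peirce_half_sqr h : (e ** h) *+ 2 = h -> e ** (e ** (h ** h)) = e ** (h ** h).
Proof.
move=> eh; have := jordan_linearized e h h e.
have Ueh : e ** (e ** h) ** h = e ** h ** (e ** h).
  by apply: jmulr2n_inj; rewrite -[LHS]jmulMnl -[RHS]jmulMnl -jmulMn eh jmulC.
rewrite ee (jmulC h e) (jmulC _ e) !(jmulC _ e) Ueh => E.
by zcombine E.
Qed.

End Peirce.

(** * BJ-algebras *)

Section BJ.
Hypothesis BJ : BJ_algebra A.

(** The idempotent is a square and equals [jU e e], so it lies in its own set; the other squares
    there are values of [jU e], which [e] fixes. *)
Lemma BJ_idempotent (S : set A) : exists e,
  [/\ jidempotent e, jperp S e &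
      forall x, jsquares A x -> jperp S x -> e ** x = x].
Proof.
have [e [ee eqS]] := BJ S; exists e; split=> //.
  suff: (jperp S `&` jsquares A) e by case.
  rewrite eqS; split; exists e => //.
  by rewrite jU_idem // !ee; zmodule.
move=> x x2 xS; have : (jperp S `&` jsquares A) x by [].
by rewrite eqS => -[[y _ <-] _]; apply: peirce_one.
Qed.

Lemma BJ_mul_unit :
  exists2 u : A, jidempotent u & forall x y, u ** (x ** y) = x ** y.
Proof.
have [u [uu _ u2]] := BJ_idempotent set0; exists u => // x y.
have usqr z : u ** (z ** z) = z ** z by apply: u2 => [|a //]; exists z.
have := usqr (x + y); rewrite !(jmulDl, jmulDr) (jmulC y x) !usqr => E.
by apply: jmulr2n_inj; zcombine E.
Qed.

Lemma BJ_half_eq0 e h : jidempotent e -> (e ** h) *+ 2 = h ->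
  e ** (h ** h) = h ** h -> h = 0.
Proof.
move=> ee eh ehh; have [u uu uM] := BJ_mul_unit.
have ue : u ** e = e by rewrite -ee uM.
have uh : u ** h = h by rewrite -eh jmulMn uM.
have fe : (u - e) ** e = 0 by rewrite jmulDl jmulNl ue ee subrr.
have ff : (u - e) ** (u - e) = u - e.
  by rewrite jmulDr jmulN fe subr0 jmulDl jmulNl uu (jmulC e) ue.
have [g [gg gf gfix]] := BJ_idempotent [set u - e].
have ge : g ** e = e.
  apply: gfix => [|_ ->]; first by exists e.
  by rewrite /jU (jmulC _ (u - e)) ff fe jmul0 mul0rn subr0.
have ug : u ** g = g by rewrite -gg uM.
have gE : g = e.
  have := gf _ erefl; rewrite jU_idem // !(jmulDl, jmulDr, jmulNl, jmulN).
  by rewrite !ug (jmulC e g) ge ue ee => E; zcombine E.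
have eeh : (e ** (e ** h)) *+ 2 = e ** h by rewrite -jmulMn eh.
have zE : (e + h) ** (e + h) = e + h + h ** h.
  rewrite !(jmulDl, jmulDr) (jmulC h e) ee.
  by zcombine eh.
(* Multiplication by [u - e] sends this square to [h/2] and then to [h/4], so [jU (u - e)] takes it
   to [2(h/4) - h/2 = 0]. *)
have ez : e ** (e + h + h ** h) = e + h + h ** h.
  rewrite -{1}gE -zE; apply: gfix => [|_ ->]; first by exists (e + h).
  rewrite zE jU_idem // !(jmulDl, jmulDr, jmulNl, jmulN).
  rewrite !ue !ee !ue !uh !uM !ehh.
  have E := congr2 +%R eeh (esym eh).
  by zcombine E.
rewrite !jmulDr ee ehh in ez.
have E := congr2 +%R eh (esym (congr2 +%R ez ez)).
by zcombine E.
Qed.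

Lemma BJ_sqr_nil b : (b ** b) ** (b ** b) = 0 -> b ** b = 0.
Proof.
move=> b4; have [e [ee eb e_fix]] := BJ_idempotent [set b].
have eb2 : e ** (b ** b) = b ** b.
  apply: e_fix => [|_ ->]; first by exists b.
  by rewrite /jU b4 subr0 (jmulC b) jordan_identity b4 mul0rn.
have := eb b erefl; rewrite /jU (jmulC b e) (jmulC (b ** b)) eb2 => {}eb.
(* [b1], [4k] and [b0] are the Peirce components of [b]. *)
pose b1 := jU e b; pose k := e ** b - e ** (e ** b); pose b0 := b - b1 - k *+ 4.
have eb1 : e ** b1 = b1 by apply: peirce_one.
have ek : (e ** k) *+ 2 = k by apply: peirce_half.
have eb0 : e ** b0 = 0 by apply: peirce_zero.
pose h := k *+ 4.
have eh : (e ** h) *+ 2 = h by rewrite jmulMn -mulrnA mulnC mulrnA ek.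
have bE : b = b1 + h + b0 by rewrite /b0 /h; zmodule.
clearbody b1 b0 h; clear k ek; subst b.
have b10 : b1 ** b0 = 0.
  by rewrite jmulC -{1}eb1 -peirce_zero_mul // (jmulC b0) peirce_one_mul // eb0 jmul0.
have eb11 : e ** (b1 ** b1) = b1 ** b1 by rewrite peirce_one_mul // eb1.
have eb00 : e ** (b0 ** b0) = 0 by rewrite peirce_zero_mul // eb0 jmul0.
have eb1h : (e ** (b1 ** h)) *+ 2 = b1 ** h by rewrite peirce_one_mul // -jmulMn eh.
have eb0h : (e ** (b0 ** h)) *+ 2 = b0 ** h by rewrite peirce_zero_mul // -jmulMn eh.
have ehh := peirce_half_sqr ee eh.
have h2 x : (e ** h ** x) *+ 2 = h ** x by rewrite -jmulMnl eh.
(* Expanded in components, [e b^2 = b^2] becomes [E1] and [2 (e b) b = b^2] becomes [E2]. *)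
move: eb2 eb; rewrite !(jmulDl, jmulDr) eb1 eb0 eb11 eb00 !jmul0l.
rewrite !(jmulC h b1) !(jmulC h b0) !(jmulC b0 b1) b10 jmul0.
move: (h2 b1) (h2 b0) (h2 h); rewrite (jmulC h b1) (jmulC h b0) => H1 H0 Hh E1 E2.
have eT : b0 ** b0 + h ** h + b1 ** h + b0 ** h = e ** (h ** h).
  have E := congr2 +%R (esym E1) (congr2 +%R eb1h eb0h); by zcombine E.
(* Applying [e] to [eT] fixes [e h^2], kills [b0^2] and halves the mixed products, isolating the
   latter. *)
have v10 : b1 ** h + b0 ** h = 0.
  have := congr1 (jmul e) eT; rewrite !jmulDr eb00 ehh => E3.
  have E := congr2 +%R (congr2 +%R E3 E3) (congr2 +%R (esym eb1h) (esym eb0h)).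
  by zcombine E.
have eS : b1 ** b1 + b1 ** h + b1 ** h = b0 ** b0.
  have E := congr2 +%R (congr2 +%R E2 v10)
    (congr2 +%R (esym H1) (congr2 +%R (esym H0) (esym Hh))).
  by zcombine E.
(* Each application of [e] keeps [b1^2], halves [b1 h] and kills [b0^2]; two of them separate the
   terms. *)
have eW : b1 ** b1 + b1 ** h = 0.
  have := congr1 (jmul e) eS; rewrite !jmulDr eb00 eb11 => E3.
  have E := congr2 +%R E3 (esym eb1h); by zcombine E.
have v1 : b1 ** h = 0.
  have := congr1 (jmul e) eW; rewrite jmulDr eb11 jmul0 => /esym E3.
  have E4 := congr2 +%R eW E3.
  have E := congr2 +%R (congr2 +%R E4 E4) eb1h; by zcombine E.
move: eS eW v10 eT; rewrite v1 !(addr0, add0r) => <- -> ->.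
rewrite !(addr0, add0r) => /esym ehh1.
have -> : h = 0 by apply: BJ_half_eq0 ee eh ehh1.
by rewrite jmul0.
Qed.

End BJ.
End JordanIdentities.

Theorem lemma2p3 (F : fieldType) (hF : 2%N \notin [pchar F])
    (A : jordanAlgType F) (hA : BJ_algebra A) :
  (exists e : A, forall a : A, jsquares A a -> a ** e = a /\ e ** a = a) /\
  (forall (a : A) (n : nat),
     jsquares A a -> (1 <= n)%N -> jexp a n = 0 -> a = 0).
Proof.
split.
  have [u uu uM] := BJ_mul_unit hF hA.
  by exists u => _ [x _ <-]; rewrite jmulC uM.
(* The exponent drops by one: with [a = b^2] and [c = b^(n+1)], [a^(n+1) = c^2], while
   [c^4 = a^(2n+2)] vanishes because [a^(n+2)] does. *)
move=> _ [//|n] [b _ <-] _; elim: n => [//|n IHn] an0; apply: IHn.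
rewrite jexp_sqr //; apply: BJ_sqr_nil => //; rewrite -jexp_sqr // jexpD //.
(* For [n = 0] the two exponents agree; otherwise the cofactor of [a^(n+2)] is a genuine power, as
   [jexpD] requires. *)
case: n an0 => [//|n] an0.
by rewrite addnS -addSn -jexpD // an0 jmul0l.
Qed.
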